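(* Let $K$ be a field of characteristic zero, let $X$ be a set, and let $H(x)=\langle H_n(x)\rangle_{n\ge 0}$ be a sequence of functions $X\to K$ given by $$H_n(x)=A(x)\,p(x)^n+B(x)\,q(x)^n,\qquad A(x)=\frac{b(x)-q(x)a(x)}{p(x)-q(x)},\qquad B(x)=-\frac{b(x)-p(x)a(x)}{p(x)-q(x)},$$ i.e. the Ward-Horadam functions' sequence with initial values $H_0(x)=a(x)$, $H_1(x)=b(x)$ and characteristic roots $p(x),q(x)$. Assume $H_n(x)\neq 0$ for all $n\ge 1$ and all $x\in X$. Let $r,s$ be positive integers and let $h_1(r,s)=h_1(r,s)(x)$ and $h_2(r,s)=h_2(r,s)(x)$ be functions on $X$ with values in a field containing $K$ and the values of $p$ and $q$. Then the recurrence $$\binom{r+s}{r,s}_{H(x)}=h_1(r,s)\binom{r+s-1}{r-1,s}_{H(x)}+h_2(r,s)\binom{r+s-1}{r,s-1}_{H(x)},$$ where $\binom{r}{r,0}_{H(x)}=\binom{s}{0,s}_{H(x)}=1$, is equivalent to $$H_{r+s}(x)=h_1(r,s)\,H_r(x)+h_2(r,s)\,H_s(x).$$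
   Context: A Ward-Horadam functions' sequence is the solution $\langle H_n(x)\rangle_{n\ge 0}$ of the second order recurrence $$H_{n+2}(x)=\sigma(x)H_{n+1}(x)+\tau(x)H_n(x),\quad n\ge 0,\qquad H_0(x)=a(x),\ H_1(x)=b(x),$$ where $a,b,\sigma,\tau$ are given $K$-valued functions on $X$. The functions $p(x),q(x)$ (with values in $K$ or an extension field) are the roots of the characteristic equation $z^2-\sigma(x)z-\tau(x)=0$. Standing assumptions, for all $x\in X$: $p(x)\ne q(x)$, $p(x)\ne 0\ne q(x)$, $p(x)/q(x)$ is not a root of unity, and $A(x)\ne 0\ne B(x)$ (so the sequence is a genuinely second order one). The $H(x)$-factorial is $H_n(x)!=H_n(x)H_{n-1}(x)\cdots H_1(x)$, with $H_0(x)!=1$ (empty product). For nonnegative integers $r,s$ the $H(x)$-binomial coefficient in multinomial notation is $$\binom{r+s}{r,s}_{H(x)}=\frac{H_{r+s}(x)!}{H_r(x)!\,H_s(x)!}.$$ *)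

(* Defs.v *)
From HB Require Import structures.
From mathcomp Require Import all_boot all_order all_algebra.
From mathcomp Require Import ring.

Set Implicit Arguments.
Unset Strict Implicit.
Unset Printing Implicit Defensive.

Import GRing.Theory.
Local Open Scope ring_scope.

Definition ward_horadam (K : fieldType) (X : Type) (a b sigma tau : X -> K)
    (H : nat -> X -> K) : Prop :=
  [/\ forall x, H 0%N x = a x,
      forall x, H 1%N x = b x
    & forall n x, H n.+2 x = sigma x * H n.+1 x + tau x * H n x].

Definition char_poly2 (K : fieldType) (sigma tau : K) : {poly K} :=
  'X^2 - sigma *: 'X - tau%:P.

(* [a], [b] have values in [K], but [p], [q] only in an extension [L], given
   by the (injective) morphism [iota]; the coefficients [A], [B] thus live
   in [L]. *)
Definition binetA (K L : fieldType) (iota : {rmorphism K -> L}) (X : Type)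
    (a b : X -> K) (p q : X -> L) (x : X) : L :=
  (iota (b x) - q x * iota (a x)) / (p x - q x).

Definition binetB (K L : fieldType) (iota : {rmorphism K -> L}) (X : Type)
    (a b : X -> K) (p q : X -> L) (x : X) : L :=
  - ((iota (b x) - p x * iota (a x)) / (p x - q x)).

Definition hfact (K : fieldType) (X : Type) (H : nat -> X -> K) (n : nat)
    (x : X) : K :=
  \prod_(1 <= i < n.+1) H i x.

(* Multinomial notation: the upper index [r + s] is determined by [r], [s]. *)
Definition hbinom (K : fieldType) (X : Type) (H : nat -> X -> K) (r s : nat)
    (x : X) : K :=
  hfact H (r + s) x / (hfact H r x * hfact H s x).

(* For distinct characteristic roots, the recurrence and the closed form
   describe the same sequence. *)
Lemma ward_horadam_binet (K L : fieldType) (iota : {rmorphism K -> L})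
    (X : Type) (a b sigma tau : X -> K) (p q : X -> L) (H : nat -> X -> K) :
  (forall x, root (map_poly iota (char_poly2 (sigma x) (tau x))) (p x)) ->
  (forall x, root (map_poly iota (char_poly2 (sigma x) (tau x))) (q x)) ->
  (forall x, p x != q x) ->
  ward_horadam a b sigma tau H <->
  (forall n x, iota (H n x) = binetA iota a b p q x * p x ^+ n
                              + binetB iota a b p q x * q x ^+ n).
Proof.
move=> rp rq npq.
have rE z x : root (map_poly iota (char_poly2 (sigma x) (tau x))) z ->
    z ^+ 2 = iota (sigma x) * z + iota (tau x).
  rewrite /root /char_poly2 !rmorphB /= map_polyXn map_polyZ map_polyX map_polyC.
  rewrite !hornerE -addrA -opprD subr_eq0 => /eqP; exact.
have d0 x : p x - q x != 0 by rewrite subr_eq0.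
have B0 x : binetA iota a b p q x + binetB iota a b p q x = iota (a x).
  by rewrite /binetA /binetB; field; exact: d0.
have B1 x : binetA iota a b p q x * p x + binetB iota a b p q x * q x
    = iota (b x).
  by rewrite /binetA /binetB; field; exact: d0.
have step n x (u v : L) : u * p x ^+ n.+2 + v * q x ^+ n.+2
    = iota (sigma x) * (u * p x ^+ n.+1 + v * q x ^+ n.+1)
      + iota (tau x) * (u * p x ^+ n + v * q x ^+ n).
  by rewrite -(addn2 n) !exprD (rE _ _ (rp x)) (rE _ _ (rq x)) !exprSr; ring.
split=> [[H0 H1 HS] n x | HB].
  suff [] : iota (H n x) = binetA iota a b p q x * p x ^+ n
                           + binetB iota a b p q x * q x ^+ n
         /\ iota (H n.+1 x) = binetA iota a b p q x * p x ^+ n.+1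
                           + binetB iota a b p q x * q x ^+ n.+1 by [].
  elim: n => [|n [IH0 IH1]].
    by rewrite !expr0 !expr1 !mulr1 B0 B1 H0 H1.
  by split=> //; rewrite HS rmorphD !rmorphM IH0 IH1 step.
split=> [x|x|n x]; apply: (fmorph_inj iota).
- by rewrite HB !expr0 !mulr1 B0.
- by rewrite HB !expr1 B1.
- by rewrite rmorphD !rmorphM !HB step.
Qed.

(* Main.v *)
Require Import Defs.
From mathcomp Require Import all_boot all_order all_algebra.

Import GRing.Theory.
Local Open Scope ring_scope.

(** The three binomial coefficients of the recurrence share a nonzero factor:
    with [c = H_{r+s-1}! / (H_r! H_s!)], the coefficient indexed by [(r, s)] is
    [c * H_{r+s}], that indexed by [(r - 1, s)] is [c * H_r], and that indexed
    by [(r, s - 1)] is [c * H_s] (lemmas [hbinomE], [hbinom_predl] and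
    [hbinom_predr]). Hence the binomial recurrence at a point [x] is [iota c]
    times the linear relation at [x], and [iota c] can be cancelled. *)

Set Implicit Arguments.
Unset Strict Implicit.

Section HBinomial.

Variables (K : fieldType) (X : Type) (H : nat -> X -> K) (x : X).
Hypothesis H_neq0 : forall n, (1 <= n)%N -> H n x != 0.

Lemma hfact0 : hfact H 0 x = 1.
Proof. by rewrite /hfact big_geq. Qed.

Lemma hfactS n : hfact H n.+1 x = hfact H n x * H n.+1 x.
Proof. by rewrite /hfact big_nat_recr. Qed.

Lemma hfact_neq0 n : hfact H n x != 0.
Proof.
elim: n => [|n IHn]; first by rewrite hfact0 oner_neq0.
by rewrite hfactS mulf_neq0 ?H_neq0.
Qed.

Lemma hbinomn0 n : hbinom H n 0 x = 1.
Proof. by rewrite /hbinom addn0 hfact0 mulr1 divff ?hfact_neq0. Qed.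

Lemma hbinom0n n : hbinom H 0 n x = 1.
Proof. by rewrite /hbinom add0n hfact0 mul1r divff ?hfact_neq0. Qed.

(** The common factor [H_{r+s-1}! / (H_r! H_s!)]. *)
Definition hbinom_coef (r s : nat) : K :=
  hfact H (r + s).-1 x / (hfact H r x * hfact H s x).

Lemma hbinom_coef_neq0 r s : hbinom_coef r s != 0.
Proof. by rewrite mulf_neq0 ?invr_eq0 ?mulf_neq0 ?hfact_neq0. Qed.

Lemma hbinomE r s : (0 < r)%N ->
  hbinom H r s x = hbinom_coef r s * H (r + s)%N x.
Proof. by case: r => // r _; rewrite /hbinom addSn hfactS mulrAC. Qed.

Lemma hbinom_predl r s : (0 < r)%N ->
  hbinom H r.-1 s x = hbinom_coef r s * H r x.
Proof.
case: r => // r _; rewrite /hbinom /hbinom_coef addSn /= hfactS.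
by rewrite (mulrAC _ (H _ x)) [in RHS]invfM mulrA divfK ?H_neq0.
Qed.

Lemma hbinomC r s : hbinom H r s x = hbinom H s r x.
Proof. by rewrite /hbinom addnC [X in _ / X]mulrC. Qed.

Lemma hbinom_predr r s : (0 < s)%N ->
  hbinom H r s.-1 x = hbinom_coef r s * H s x.
Proof.
move=> s_gt0; rewrite hbinomC hbinom_predl //.
by rewrite /hbinom_coef addnC [X in _ / X]mulrC.
Qed.

End HBinomial.

Unset Implicit Arguments.
Set Strict Implicit.

Theorem mainTheorem1 (K : fieldType) (charK : [pchar K] =i pred0)
    (L : fieldType) (iota : {rmorphism K -> L}) (X : Type)
    (a b sigma tau : X -> K) (p q : X -> L) (H : nat -> X -> K)
    (root_p : forall x, root (map_poly iota (char_poly2 (sigma x) (tau x))) (p x))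
    (root_q : forall x, root (map_poly iota (char_poly2 (sigma x) (tau x))) (q x))
    (neq_pq : forall x, p x != q x)
    (p_neq0 : forall x, p x != 0)
    (q_neq0 : forall x, q x != 0)
    (pq_unity : forall x n, (0 < n)%N -> ~~ n.-unity_root (p x / q x))
    (A_neq0 : forall x, binetA iota a b p q x != 0)
    (B_neq0 : forall x, binetB iota a b p q x != 0)
    (H_wh : ward_horadam a b sigma tau H)
    (H_binet : forall n x,
       iota (H n x) = binetA iota a b p q x * p x ^+ n
                      + binetB iota a b p q x * q x ^+ n)
    (H_neq0 : forall n x, (1 <= n)%N -> H n x != 0)
    (r s : nat) (r_gt0 : (0 < r)%N) (s_gt0 : (0 < s)%N)
    (h1 h2 : nat -> nat -> X -> L) :
  (forall x, hbinom H r 0 x = 1 /\ hbinom H 0 s x = 1) /\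
  ((forall x, iota (hbinom H r s x)
              = h1 r s x * iota (hbinom H r.-1 s x)
                + h2 r s x * iota (hbinom H r s.-1 x))
   <->
   (forall x, iota (H (r + s)%N x)
              = h1 r s x * iota (H r x) + h2 r s x * iota (H s x))).
Proof.
have Hx x n : (1 <= n)%N -> H n x != 0 by exact: H_neq0.
split=> [x|]; first by rewrite (hbinomn0 (Hx x)) (hbinom0n (Hx x)).
have pointwise x :
    iota (hbinom H r s x) = h1 r s x * iota (hbinom H r.-1 s x)
                            + h2 r s x * iota (hbinom H r s.-1 x)
    <-> iota (H (r + s)%N x) = h1 r s x * iota (H r x) + h2 r s x * iota (H s x).
  rewrite hbinomE // (hbinom_predl (Hx x)) // (hbinom_predr (Hx x)) //.
  have : hbinom_coef H x r s != 0 by apply: hbinom_coef_neq0; exact: Hx.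
  move: (hbinom_coef H x r s) => c c_neq0.
  rewrite !rmorphM !(mulrCA _ (iota c)) -mulrDr.
  have /mulfI icI : iota c != 0 by rewrite fmorph_eq0.
  by split=> [/icI|->].
by split=> rec x; apply/pointwise.
Qed.
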